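(* Let $C\subset\{a,b\}^*$ be a finite maximal prefix-free set with associated prefix-closed set $P$ having $n=|P|=|C|-1\ge 0$ elements. Let $$\tilde C_a=C\setminus C_b=\begin{cases} C_a & \text{if } C\neq\{1\},\\ \{1\} & \text{if } C=\{1\}\end{cases}$$ be the set of all words in $C$ which do not end with $b$. Write $C=\{c_1<\dots<c_{n+1}\}$ in alphabetical order, let $k=|\tilde C_a|$, and let $i_1,\dots,i_k$ be the ranks in $C$ of the elements of $\tilde C_a$, so that $\tilde C_a=\{c_{i_1},\dots,c_{i_k}\}$. Let $\mathcal M=\{(p,c)\in (P_b\setminus\{1\})\times C_b : p<c\}$ and $M=|\mathcal M|$. Then $$M+\sum_{h=1}^k i_h=(n+1)(k-1)+k-\frac{k(k-1)}{2}.$$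
   Context: $\{a,b\}^*$ is the free monoid on the letters $a,b$, with empty word denoted $1$. A word $u$ is a prefix of $w$ if $w=uv$ for some word $v$. A subset $C\subset\{a,b\}^*$ is prefix-free if no element of $C$ is a proper prefix of another element of $C$; it is maximal if not contained in a strictly larger prefix-free set. The prefix-closed set associated to a finite maximal prefix-free set $C$ is $P=\{a,b\}^*\setminus C\{a,b\}^*$, the set of proper prefixes of words in $C$ (so $P=\emptyset$ if $C=\{1\}$). For a letter $x\in\{a,b\}$, $C_x=C\cap\{a,b\}^*x$ is the set of words of $C$ ending with $x$, and $P_x=P\cap(\{1\}\cup\{a,b\}^*x)$. The alphabetical order $<$ on $\{a,b\}^*$ (with $a<b$) is: $u<v$ iff $u$ is a proper prefix of $v$, or $u=xay$, $v=xbz$ for some words $x,y,z$. *)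

(* Defs.v *)
From mathcomp Require Import all_boot all_order all_algebra finmap.
From mathcomp Require Import boolp classical_sets functions cardinality.

Set Implicit Arguments.
Unset Strict Implicit.
Unset Printing Implicit Defensive.

Import Order.TTheory GRing.Theory Num.Theory.

Local Open Scope classical_set_scope.

(* The letters are [a := false] and [b := true], so that the library order
   [false < true] on [bool] is [a < b]; the empty word is [[::]]. *)
Definition letter := bool.
Definition la : letter := false.
Definition lb : letter := true.
Definition word := seq letter.

Definition proper_prefix (u v : word) : bool := prefix u v && (u != v).

Definition prefix_free (C : set word) : Prop :=
  forall u v, C u -> C v -> ~ proper_prefix u v.

Definition maximal_prefix_free (C : set word) : Prop :=
  prefix_free C /\ ~ exists D : set word, prefix_free D /\ C `<` D.

(* {a,b}^* \ C{a,b}^* *)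
Definition prefix_closed_of (C : set word) : set word :=
  ~` [set w | exists c v : word, C c /\ w = c ++ v].

Lemma prefix_closed_ofE (C : set word) : maximal_prefix_free C ->
  prefix_closed_of C = [set p | exists2 c, C c & proper_prefix p c].
Proof.
case=> pfC maxC; apply/seteqP; split=> p /=; last first.
  case=> c Cc /andP[pc npc] [c' [v [Cc' pE]]].
  have c'p : prefix c' p by apply/prefixP; exists v.
  apply: (pfC c' c) => //; rewrite /proper_prefix (prefix_trans c'p pc) /=.
  apply: contra npc => /eqP c'c; rewrite -{}c'c in pc *.
  have sz : size p = size c' by apply/eqP; rewrite eqn_leq !size_prefix.
  by move: pc; rewrite prefixE sz take_size eq_sym.
move=> Pp; apply: contrapT => npC; apply: maxC.
exists (C `|` [set p]); split; last first.
  split=> [c Cc|CpC]; first by left.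
  by apply: Pp; exists p, [::]; rewrite cats0; split=> //; apply: CpC; right.
move=> u v [Cu|->] [Cv|->]; first exact: pfC.
- by case/andP => /prefixP[w pE] _; apply: Pp; exists u, w.
- by move=> pv; apply: npC; exists v.
- by rewrite /proper_prefix eqxx andbF.
Qed.

(* {a,b}^* x *)
Definition ends_with (x : letter) : set word :=
  [set w | exists u : word, w = rcons u x].

Definition C_ (C : set word) (x : letter) : set word := C `&` ends_with x.

Definition P_ (C : set word) (x : letter) : set word :=
  prefix_closed_of C `&` ([set [::]] `|` ends_with x).

Definition tildeCa (C : set word) : set word := C `\` C_ C lb.

Definition alph_le (u v : word) : bool := ((u : seqlexi bool) <= v)%O.
Definition alph_lt (u v : word) : bool := ((u : seqlexi bool) < v)%O.

Lemma alph_ltP (u v : word) :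
  reflect (proper_prefix u v \/
           exists x y z : word, u = x ++ la :: y /\ v = x ++ lb :: z)
          (alph_lt u v).
Proof.
rewrite /alph_lt /proper_prefix.
apply: (iffP idP).
  elim: u v => [|s u IHu] [|t v] //= huv; first by left.
  have hst : (s <= t)%O && ((t <= s)%O ==> ((u : seqlexi bool) < v)%O) by [].
  case: (eqVneq s t) hst => [<-|nst].
    rewrite lexx /= => /IHu[|[x [y [z [-> ->]]]]].
      by rewrite eqseq_cons eqxx; left.
    by right; exists (s :: x), y, z.
  case: s t nst {huv} => [] [] // _ _.
  by right; exists [::], u, v.
case=> [|[x [y [z [-> ->]]]]]; last first.
  by elim: x => //= s x IHx; rewrite ltxi_cons lexx.
elim: u v => [|s u IHu] [|t v] //=.
case: (eqVneq s t) => //= <-; rewrite eqseq_cons eqxx /= => huv.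
by rewrite ltxi_cons lexx /= IHu.
Qed.

(* [fset_set A] is the finite set underlying [A] when [A] is finite (and the
   empty one otherwise). *)
Definition set_card (T : choiceType) (A : set T) : nat := #|` fset_set A|%fset.

Definition alph_enum (C : set word) : seq word := sort alph_le (fset_set C).

(* Ranks start at 1: the rank of c_i in C = {c_1 < c_2 < ...} is i. *)
Definition alph_rank (C : set word) (w : word) : nat := (index w (alph_enum C)).+1.

(* i_h for 1 <= h <= k: the rank in C of the h-th element of tildeCa C. *)
Definition i_ (C : set word) (h : nat) : nat :=
  alph_rank C (nth [::] (alph_enum (tildeCa C)) h.-1).

Definition calM (C : set word) : set (word * word) :=
  [set pc | (P_ C lb `\` [set [::]]) pc.1 /\ C_ C lb pc.2 /\ alph_lt pc.1 pc.2].

(* Main.v *)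
(* Deleting the trailing letters a is a bijection from the words c of C that do
   not end with b onto the words p of P that are empty or end with b (when
   C <> {1}): c is the leftmost leaf p a^m below p. It preserves being smaller
   than a given w in C_b, so that such a w has exactly one more predecessor in
   C \ C_b than in P_b \ {1}. Summing over w, the number of pairs c < w in
   (C \ C_b) x C_b is M + |C_b|. The ranks i_h count the pairs c' <= c in
   C x (C \ C_b), those with c' in C_b being complementary to the former. *)
Require Import Defs.
From mathcomp Require Import all_boot all_order all_algebra finmap.
From mathcomp Require Import boolp classical_sets functions cardinality.
From mathcomp Require Import zify lra.

Set Implicit Arguments.
Unset Strict Implicit.
Unset Printing Implicit Defensive.

Import Order.TTheory GRing.Theory Num.Theory.

Local Open Scope classical_set_scope.

(** * Finite sums and the alphabetical order *)

Lemma fset_setP (T : choiceType) (A : set T) (x : T) :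
  finite_set A -> reflect (A x) (x \in fset_set A).
Proof. by move=> finA; rewrite in_fset_set //; apply: (iffP idP); rewrite inE. Qed.

Lemma count_sum (T : Type) (P : pred T) (s : seq T) :
  count P s = (\sum_(x <- s) P x)%N.
Proof. by rewrite -sum1_count big_mkcond; apply: eq_bigr => x _; case: (P x). Qed.

Lemma sum_nat_seq_const (T : Type) (n : nat) (s : seq T) :
  (\sum_(x <- s) n = size s * n)%N.
Proof. by rewrite big_const_seq count_predT iter_addn_0 mulnC. Qed.

Lemma alph_lt_trans : transitive alph_lt.
Proof. by move=> v u w; apply: lt_trans. Qed.

Lemma alph_lt_trichotomy (u v : word) :
  (alph_lt u v + alph_lt v u + (u == v) = 1)%N.
Proof. by rewrite /alph_lt; case: (ltgtP (u : seqlexi bool) v). Qed.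

Lemma alph_lt_cat2l (p u v : word) : alph_lt (p ++ u) (p ++ v) = alph_lt u v.
Proof.
by elim: p => //= x p IHp; rewrite /alph_lt ltxi_cons lexx; exact: IHp.
Qed.

(** A first difference from [nseq m la] can only put a [lb] in [v], which makes [v] larger. Without
    a difference one word is a prefix of the other. *)
Lemma alph_lt_nseq (m : nat) (v : word) :
  alph_lt (nseq m la) v || prefix v (nseq m la).
Proof.
elim: m v => [|m IHm] [|[] v] //.
have /orP[lt_mv|le_vm] := IHm v; last by rewrite /= le_vm orbT.
by apply/orP; left; rewrite -(alph_lt_cat2l [:: la]) in lt_mv.
Qed.

(** In a strictly increasing list, the entries below a given one are exactly those listed before
    it. *)
Lemma index_alph_sort (s : seq word) (w : word) : uniq s -> w \in s ->
  index w (sort alph_le s) = count (alph_lt^~ w) s.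
Proof.
move=> us ws; have ws' : w \in sort alph_le s by rewrite mem_sort.
have sorted_s : sorted alph_lt (sort alph_le s).
  by rewrite [sorted _ _](@sort_lt_sorted _ (seqlexi bool)).
have /permP <- : perm_eq (sort alph_le s) s by rewrite perm_sort.
have := @count_lt_nth _ (seqlexi bool) w _ _ sorted_s.
move=> /(_ (index w (sort alph_le s))); rewrite index_mem nth_index //.
by move=> /(_ ws').
Qed.

(** * Deleting the trailing letters a *)

Definition strip_a (w : word) : word := rev (drop (find id (rev w)) (rev w)).

Lemma strip_a_rcons (w : word) (x : letter) :
  strip_a (rcons w x) = if x then rcons w x else strip_a w.
Proof. by rewrite /strip_a rev_rcons; case: x; rewrite /= ?drop0 ?rev_cons ?revK. Qed.

Lemma strip_aE (w : word) : exists m, w = strip_a w ++ nseq m la.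
Proof.
elim/last_ind: w => [|w x [m wE]]; first by exists 0%N.
rewrite strip_a_rcons; case: x; first by exists 0%N; rewrite cats0.
by exists m.+1; rewrite -addn1 nseqD catA -wE cats1.
Qed.

Lemma strip_a_cat_nseq (w : word) (m : nat) :
  strip_a (w ++ nseq m la) = strip_a w.
Proof.
elim: m => [|m IHm]; first by rewrite cats0.
by rewrite -addn1 nseqD catA cats1 strip_a_rcons.
Qed.

Lemma strip_a_ends (w : word) : ([set [::]] `|` ends_with lb) (strip_a w).
Proof.
elim/last_ind: w => [|w x IHw]; first by left.
by rewrite strip_a_rcons; case: x => //; right; exists w.
Qed.

Lemma strip_a_id (w : word) :
  ([set [::]] `|` ends_with lb) w -> strip_a w = w.
Proof. by case=> [->//|[u ->]]; rewrite strip_a_rcons. Qed.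

(** * The binary tree with leaves C and internal nodes P *)

Lemma prefix_closed_ofP (C : set word) (p : word) :
  prefix_closed_of C p <-> forall c, C c -> ~~ prefix c p.
Proof.
split=> [Pp c Cc|npC].
  by apply/negP => /prefixP[v pE]; apply: Pp; exists c, v.
by case=> c [v [Cc pE]]; move: (npC c Cc); rewrite pE prefix_prefix.
Qed.

Section MaximalPrefixFree.

Variable C : set word.
Hypotheses (finC : finite_set C) (maxC : maximal_prefix_free C).

Local Notation P := (prefix_closed_of C).

Lemma prefix_free_eq (u v : word) : C u -> C v -> prefix u v -> u = v.
Proof.
move=> Cu Cv uv; apply/eqP/negPn/negP => nuv.
by apply: (maxC.1 _ _ Cu Cv); apply/andP.
Qed.

Lemma prefix_closed_ofW (p v : word) : P (p ++ v) -> P p.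
Proof.
move/prefix_closed_ofP => npC; apply/prefix_closed_ofP => c /npC.
by apply: contra; apply: prefix_catl.
Qed.

Lemma finite_prefix_closed_of : finite_set P.
Proof.
pose s := [seq take i c | c <- fset_set C, i <- iota 0 (size c)].
apply: (@sub_finite_set _ _ [set` s]); last exact: finite_seq.
rewrite prefix_closed_ofE // => p [c /(fset_setP _ finC) Cc /andP[pc npc]] /=.
have szp : (size p < size c)%N.
  rewrite ltn_neqAle size_prefix // andbT; apply: contra npc => /eqP szE.
  by move: pc; rewrite prefixE szE take_size eq_sym.
move: pc; rewrite prefixE => /eqP <-.
by apply/allpairsPdep; exists c, (size p); rewrite mem_iota.
Qed.

(** Descending from [p] by the letter a must leave P, since lengths in P are bounded. The leaf met
    on the way is not a prefix of [p], hence lies strictly below [p], and at least one a is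
    appended. *)
Lemma prefix_closed_of_leftmost_leaf (p : word) :
  P p -> exists m, C (p ++ nseq m.+1 la).
Proof.
move=> Pp; pose N := (\max_(c <- fset_set C) size c)%N.
have leN c : C c -> (size c <= N)%N.
  by move=> /(fset_setP _ finC) Cc; apply: leq_bigmax_seq.
(* A word of P is a proper prefix of a word of C, so its length is less than [N]; [p ++ nseq N la]
   is too long for that. *)
have [PN|] := pselect (P (p ++ nseq N la)).
  move: PN; rewrite prefix_closed_ofE // => -[c Cc /andP[pc npc]].
  exfalso; case/prefixP: pc npc => -[|x v] cE; rewrite cE ?cats0 ?eqxx //.
  by have := leN _ Cc; rewrite cE !size_cat size_nseq /=; lia.
move=> /contrapT [c [v [Cc pNE]]].
have ncp : ~~ prefix c p by move/prefix_closed_ofP: Pp; exact.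
have cE : c = take (size c) (p ++ nseq N la) by rewrite pNE take_size_cat.
have lt_pc : (size p < size c)%N.
  rewrite ltnNge; apply: contra ncp => le_cp.
  by rewrite cE takel_cat // prefix_take.
exists (size c - size p).-1; rewrite prednK ?subn_gt0 //.
suff -> : p ++ nseq (size c - size p) la = c by [].
rewrite [RHS]cE take_cat ltnNge (ltnW lt_pc) /=; congr (_ ++ _).
by rewrite take_nseq //; have := congr1 size pNE; rewrite !size_cat size_nseq; lia.
Qed.

(** The nodes of the tree are the root and the two children of each internal node, so |C| + |P| = 1
    + 2|P|. *)
Lemma card_maximal_prefix_free : set_card C = (set_card P).+1.
Proof.
have finP := finite_prefix_closed_of.
have Cnil_or_P : C [::] \/ P [::].
  have [P0|/contrapT[c [v [Cc]]]] := pselect (P [::]); first by right.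
  by case: c Cc => // C0 _; left.
(* A node [rcons w x] has its parent [w] in P, for a leaf has no proper prefix in C. Conversely, a
   word of C that is a prefix of [rcons w x] but not of [w] is [rcons w x] itself. *)
have PCE w x : (P (rcons w x) \/ C (rcons w x)) <-> P w.
  split=> [[|Cwx]|Pw]; first by rewrite -cats1; apply: prefix_closed_ofW.
    apply/prefix_closed_ofP => c Cc; apply/negP => cw.
    have cwx := prefix_trans cw (prefix_rcons w x).
    have := size_prefix cw.
    by rewrite (prefix_free_eq Cc Cwx cwx) size_rcons ltnn.
  have [Pwx|/contrapT[c [v [Cc]]]] := pselect (P (rcons w x)); first by left.
  case/lastP: v => [|v y]; first by rewrite cats0 => ->; right.
  rewrite -rcons_cat => /rcons_inj[wE _].
  by move/prefix_closed_ofP: Pw => /(_ _ Cc); rewrite wE prefix_prefix.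
have PC w : ~ (P w /\ C w).
  by case=> /prefix_closed_ofP nC /nC; rewrite prefix_refl.
pose Q := fset_set P; pose ext x := [seq rcons w x | w <- Q].
suff /perm_size : perm_eq (fset_set C ++ Q) ([::] :: ext la ++ ext lb).
  rewrite /= !size_cat !size_map -addSn => /addIn.
  exact.
have rconsl_inj x : injective (fun w : word => rcons w x).
  by move=> u v /rcons_inj[].
have mem_ext w x y : (rcons w x \in ext y) = (w \in Q) && (x == y).
  apply/mapP/andP => [[u uQ /rcons_inj[-> ->]]|[wQ /eqP ->]] //.
  by exists w.
have nil_ext x : [::] \notin ext x.
  by apply/mapP => -[[|? ?]].
apply: uniq_perm.
- rewrite cat_uniq !fset_uniq andbT; apply/hasPn => w /(fset_setP _ finP) Pw.
  by apply/negP => /(fset_setP _ finC) Cw; apply: (PC w).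
- rewrite /= mem_cat negb_or !nil_ext cat_uniq !(map_inj_uniq (@rconsl_inj _)) ?fset_uniq //= andbT.
  apply/hasPn => _ /mapP[w wQ ->]; by rewrite mem_ext andbF.
- move=> w; rewrite mem_cat inE mem_cat.
  case/lastP: w => [|w x].
    rewrite eqxx; apply/orP; case: Cnil_or_P => [/(fset_setP _ finC)|/(fset_setP _ finP)].
      by left.
    by right.
  rewrite !mem_ext -andb_orr -size_eq0 size_rcons /=.
  have -> : (x == la) || (x == lb) by case: x.
  rewrite andbT; apply/orP/(fset_setP _ finP) => [|/(PCE _ x)].
    case=> [/(fset_setP _ finC)|/(fset_setP _ finP)] H; apply/(PCE _ x).
      by right.
    by left.
  by case=> [/(fset_setP _ finP)|/(fset_setP _ finC)]; [right|left].
Qed.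


(** * Stripping as an order-compatible bijection *)

Lemma tildeCaE :
  tildeCa C = if `[< C = [set [::]] >] then [set [::]] else C_ C la.
Proof.
case: asboolP => [->|C1]; apply/seteqP; split=> w.
- by case.
- by move=> ->; split=> // -[_ [[]]].
- case=> Cw nCbw; case/lastP: w Cw nCbw => [|w [] Cw nCbw].
  + move=> C0 _; exfalso; apply: C1; apply/seteqP; split=> [v Cv|_ ->//].
    exact: esym (prefix_free_eq C0 Cv (prefix0s v)).
  + by case: nCbw; split=> //; exists w.
  + by split=> //; exists w.
- by case=> Cw [u wE]; split=> // -[_ [v]]; rewrite wE => /rcons_inj[].
Qed.

(** Write c = p a^m with p stripped. If p and [w] differ at some letter, so do c and [w], at the
    same place. If w = p v, then either a^m < v, or v is a prefix of a^m; in the latter case [w] is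
    a prefix of [c], so w = c, although only [w] ends with b. Conversely, p is c or a proper prefix
    of c, hence p < w when c < w. *)
Lemma alph_lt_strip_a (c w : word) :
  tildeCa C c -> C_ C lb w -> alph_lt (strip_a c) w = alph_lt c w.
Proof.
move=> [Cc nCbc] Cbw; have Cw := Cbw.1; have [m cE] := strip_aE c.
apply/idP/idP => [|lt_cw].
  case/alph_ltP => [/andP[/prefixP[v wE] _]|[x [y [z [pE wE]]]]].
    have := alph_lt_nseq m v; rewrite -(alph_lt_cat2l (strip_a c)) -cE -wE.
    case/orP => // /prefixP[v' mE].
    have wc : prefix w c by apply/prefixP; exists v'; rewrite cE wE mE catA.
    by case: nCbc; rewrite -(prefix_free_eq Cw Cc wc).
  apply/alph_ltP; right; exists x, (y ++ nseq m la), z.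
  by rewrite {1}cE pE -catA.
case: m cE => [|m] cE; first by rewrite cats0 in cE; rewrite -cE.
apply: alph_lt_trans lt_cw; apply/alph_ltP; left.
by rewrite /proper_prefix {2 4}cE prefix_prefix -{1}[strip_a c]cats0 eqseq_cat ?eqxx.
Qed.

(** Two words with the same stripped form are prefix-comparable, hence equal in C: this is
    injectivity. Surjectivity is given by the leftmost leaf below [p]. *)
Lemma perm_strip_a : ~ C [::] ->
  perm_eq (map strip_a (fset_set (tildeCa C))) (fset_set (P_ C lb)).
Proof.
move=> nC0.
have finT : finite_set (tildeCa C) by apply: sub_finite_set finC => w [].
have finPb : finite_set (P_ C lb).
  by apply: sub_finite_set finite_prefix_closed_of => w [].
apply: uniq_perm.
- rewrite map_inj_in_uniq ?fset_uniq // => c c' /(fset_setP _ finT)[Cc _].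
  move=> /(fset_setP _ finT)[Cc' _].
  have [m cE] := strip_aE c; have [m' c'E] := strip_aE c'.
  wlog le_mm' : c c' m m' Cc Cc' cE c'E / (m <= m')%N.
    move=> th eq_cc'; have [le_mm'|/ltnW le_m'm] := leqP m m'.
      exact: (th c c' m m').
    by apply/esym/(th c' c m' m).
  move=> eq_cc'; apply: (prefix_free_eq Cc Cc'); rewrite cE c'E eq_cc'.
  by rewrite -(subnKC le_mm') nseqD catA prefix_prefix.
- exact: fset_uniq.
move=> p; apply/mapP/(fset_setP _ finPb) => [[c /(fset_setP _ finT)[Cc nCbc] ->]|].
  split; last exact: strip_a_ends.
  apply/prefix_closed_ofP => c' Cc'; apply/negP => c'p.
  (* A word left unchanged by stripping is empty or ends with b, both excluded for [c]. So the
     stripped word is a proper prefix of [c] and has no prefix in C. *)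
  have [[|m] cE] := strip_aE c.
    rewrite cats0 in cE; have := strip_a_ends c; rewrite -cE => -[c0|cb].
      by apply: nC0; rewrite -c0.
    by apply: nCbc.
  have c'c : prefix c' c by rewrite cE prefix_catl.
  have := size_prefix c'p; rewrite (prefix_free_eq Cc' Cc c'c) {1}cE.
  by rewrite size_cat /= addnS ltnNge leq_addr.
case=> Pp pb; have [m Cpm] := prefix_closed_of_leftmost_leaf Pp.
exists (p ++ nseq m.+1 la); last by rewrite strip_a_cat_nseq strip_a_id.
apply/(fset_setP _ finT); split=> // -[_ [u]].
by rewrite -addn1 nseqD catA cats1 => /rcons_inj[].
Qed.

(** The extra predecessor is the empty word: it belongs to [P_ C lb] and precedes [w], which is
    nonempty. *)
Lemma count_tildeCa_lt (w : word) : C_ C lb w ->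
  count (alph_lt^~ w) (fset_set (tildeCa C)) =
  (count (alph_lt^~ w) (fset_set (P_ C lb `\` [set [::]]))).+1.
Proof.
move=> Cbw; have [Cw [u wE]] := Cbw.
have nC0 : ~ C [::].
  by move=> C0; have := prefix_free_eq C0 Cw (prefix0s w); rewrite wE; case: (u).
have finT : finite_set (tildeCa C) by apply: sub_finite_set finC => v [].
have finPb : finite_set (P_ C lb).
  by apply: sub_finite_set finite_prefix_closed_of => v [].
have finPb1 : finite_set (P_ C lb `\` [set [::]]).
  by apply: sub_finite_set finPb => v [].
transitivity (count (alph_lt^~ w) (map strip_a (fset_set (tildeCa C)))).
  rewrite count_map; apply: eq_in_count => c /(fset_setP _ finT) Tc /=.
  by rewrite alph_lt_strip_a.
have /permP -> := perm_strip_a nC0.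
have P0 : P [::].
  apply/prefix_closed_ofP => c Cc; rewrite prefixs0; apply/eqP => c0.
  by apply: nC0; rewrite -c0.
have /permP -> : perm_eq (fset_set (P_ C lb))
    ([::] :: fset_set (P_ C lb `\` [set [::]])).
  apply: uniq_perm; rewrite /= ?fset_uniq ?andbT //.
    by apply/negP => /(fset_setP _ finPb1)[_]; exact.
  move=> p; rewrite inE; apply/(fset_setP _ finPb)/orP => [Pbp|].
    have [->|p0] := eqVneq p [::]; [by left|right].
    by apply/(fset_setP _ finPb1); split=> //; apply/eqP.
  case=> [/eqP ->|/(fset_setP _ finPb1)[]] //.
  by split=> //; left.
by rewrite /= (_ : alph_lt [::] w) // wE; case: (u).
Qed.

(** * Pair counts and rank sums *)

Lemma card_calM :
  set_card (calM C) = (\sum_(w <- fset_set (C_ C lb))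
    count (alph_lt^~ w) (fset_set (P_ C lb `\` [set [::]])))%N.
Proof.
have finB : finite_set (C_ C lb) by apply: sub_finite_set finC => v [].
have finPb1 : finite_set (P_ C lb `\` [set [::]]).
  by apply: sub_finite_set finite_prefix_closed_of => v [[]].
have finM : finite_set (calM C).
  apply: sub_finite_set (finite_setX finPb1 finB) => -[p c] /= [? [? _]].
  by split.
(* The words of [C_ C lb] form the outer loop, so that the size of the filtered list is directly a
   sum over them. *)
pose s := [seq (p, c) | c <- fset_set (C_ C lb),
                        p <- fset_set (P_ C lb `\` [set [::]])].
have /perm_size : perm_eq (fset_set (calM C)) [seq x <- s | alph_lt x.1 x.2].
  apply: uniq_perm; rewrite ?fset_uniq // ?filter_uniq //.
    by apply: allpairs_uniq; rewrite ?fset_uniq // => -[? ?] [? ?] _ _ /= [-> ->].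
  move=> [p c]; rewrite mem_filter.
  apply/(fset_setP _ finM)/andP => /= [[Pbp [Bc ltpc]]|[ltpc]].
    split=> //; apply/allpairsP; exists (c, p).
    by split=> //; apply/fset_setP.
  case/allpairsP => -[c' p'] /= [/(fset_setP _ finB) Bc /(fset_setP _ finPb1) Pbp].
  by case=> pp cc; subst p c; exact: (conj Pbp (conj Bc ltpc)).
rewrite /set_card => ->; rewrite size_filter count_sum big_allpairs_dep.
by apply: eq_bigr => w _; rewrite count_sum.
Qed.

(** Ranks start at 1, so the rank of [c] is one more than the number of words of C below [c].
    Listing the set in another order does not change the sum. *)
Lemma sum_i_ : (\sum_(1 <= h < (set_card (tildeCa C)).+1) i_ C h =
  \sum_(c <- fset_set (tildeCa C)) (count (alph_lt^~ c) (fset_set C)).+1)%N.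
Proof.
have finT : finite_set (tildeCa C) by apply: sub_finite_set finC => v [].
have enumT : perm_eq (alph_enum (tildeCa C)) (fset_set (tildeCa C)).
  by rewrite perm_sort.
rewrite -(perm_big _ enumT) /= (big_nth [::]) size_sort big_add1 /=; apply: eq_big_nat => h /andP[_ hk].
rewrite /i_ /alph_rank index_alph_sort ?fset_uniq //=; apply/(fset_setP _ finC).
have : nth [::] (alph_enum (tildeCa C)) h \in fset_set (tildeCa C).
  by rewrite -(mem_sort alph_le) mem_nth // size_sort.
by case/(fset_setP _ finT).
Qed.

Lemma perm_tildeCa_Cb : perm_eq (fset_set C)
  (fset_set (tildeCa C) ++ fset_set (C_ C lb)).
Proof.
have finT : finite_set (tildeCa C) by apply: sub_finite_set finC => v [].
have finB : finite_set (C_ C lb) by apply: sub_finite_set finC => v [].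
apply: uniq_perm; rewrite ?fset_uniq // ?cat_uniq ?fset_uniq ?andbT /=.
  apply/hasPn => w /(fset_setP _ finB) Bw.
  by apply/negP => /(fset_setP _ finT)[_]; exact.
move=> w; rewrite mem_cat.
apply/(fset_setP _ finC)/orP => [Cw|]; last first.
  by case=> [/(fset_setP _ finT)|/(fset_setP _ finB)] [].
have [Bw|nBw] := pselect (C_ C lb w); [right|left].
  exact/fset_setP.
exact/fset_setP.
Qed.

End MaximalPrefixFree.

(** Transposing one of the two copies of the sum, each ordered pair (u, w) satisfies exactly one of
    u < w, w < u and u = w; the diagonal accounts for [size s]. *)
Lemma sum_count_alph_lt (s : seq word) : uniq s ->
  (2 * (\sum_(w <- s) count (alph_lt^~ w) s) + size s = size s * size s)%N.
Proof.
move=> us; have sizeE : size s = (\sum_(w <- s) \sum_(u <- s) (u == w))%N.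
  rewrite -sum1_size; apply: eq_big_seq => w ws.
  by rewrite -(count_sum (pred1 w)) count_uniq_mem // ws.
under eq_bigr do rewrite count_sum.
rewrite {1}sizeE mul2n -addnn {2}exchange_big -!big_split -sum_nat_seq_const /=.
apply: eq_bigr => w _; rewrite -!big_split -sum1_size /=.
by apply: eq_bigr => u _; rewrite alph_lt_trichotomy.
Qed.

(** The same trichotomy, where disjointness rules out the diagonal. *)
Lemma sum_count_alph_lt_disjoint (s t : seq word) : {in s, forall w, w \notin t} ->
  (\sum_(w <- s) count (alph_lt^~ w) t + \sum_(w <- t) count (alph_lt^~ w) s
   = size s * size t)%N.
Proof.
move=> dis; under eq_bigr do rewrite count_sum.
under [X in (_ + X)%N]eq_bigr do rewrite count_sum.
rewrite [X in (_ + X)%N]exchange_big /= -big_split /= -sum_nat_seq_const.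
apply: eq_big_seq => w ws; rewrite -big_split /= -sum1_size.
apply: eq_big_seq => u ut; have := alph_lt_trichotomy u w.
by case: eqVneq (dis _ ws) => [<-|_ _]; rewrite ?ut ?addn0.
Qed.

(** * Combining the counts *)

Local Open Scope ring_scope.

Theorem lemma3 (C : set word) (n k M : nat)
    (finC : finite_set C) (maxC : maximal_prefix_free C)
    (hn : n = set_card (prefix_closed_of C))
    (hk : k = set_card (tildeCa C))
    (hM : M = set_card (calM C)) :
  [/\ set_card C = n.+1,
      tildeCa C = (if `[< C = [set [::]] >] then [set [::]] else C_ C la) &
      M%:R + \sum_(1 <= h < k.+1) (i_ C h)%:R
      = (n%:R + 1) * (k%:R - 1) + k%:R - k%:R * (k%:R - 1) / 2%:R :> rat].
Proof.
have cardC : set_card C = n.+1 by rewrite hn card_maximal_prefix_free.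
split; [exact: cardC|exact: tildeCaE|].
have finT : finite_set (tildeCa C) by apply: sub_finite_set finC => v [].
have finB : finite_set (C_ C lb) by apply: sub_finite_set finC => v [].
have perm_TB := perm_tildeCa_Cb finC.
pose T := fset_set (tildeCa C) : seq word.
pose B := fset_set (C_ C lb) : seq word.
pose TT := (\sum_(w <- T) count (alph_lt^~ w) T)%N.
pose TB := (\sum_(w <- T) count (alph_lt^~ w) B)%N.
have kbE : (n.+1 = k + size B)%N.
  by rewrite -cardC hk -size_cat; apply: perm_size.
(* The predecessors in C of a word of [T] split into those in [T] and those in [B]; the summand [k]
   comes from ranks starting at 1. *)
have sumE : (\sum_(1 <= h < k.+1) i_ C h = TT + TB + k)%N.
  rewrite hk sum_i_ // -[set_card _]muln1 -sum_nat_seq_const -!big_split /=.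
  by apply: eq_bigr => w _; have /permP -> := perm_TB; rewrite count_cat addn1.
have TTE : (2 * TT + k = k * k)%N by rewrite hk; apply/sum_count_alph_lt/fset_uniq.
(* The pairs of [T] and [B] in the other order number [M + size B]: each word of [B] contributes one
   extra predecessor, the empty word. *)
have TBE : (TB + (M + size B) = k * size B)%N.
  rewrite hM card_calM // hk -sum_count_alph_lt_disjoint; last first.
    move=> w /(fset_setP _ finT)[_ nBw].
    by apply/negP => /(fset_setP _ finB) /nBw.
  congr (_ + _)%N; rewrite -[size B]muln1 -sum_nat_seq_const -big_split /=.
  by apply: eq_big_seq => w /(fset_setP _ finB) Bw; rewrite count_tildeCa_lt ?addn1.
rewrite -natr_sum sumE !natrD.
(* Once n + 1 is replaced by k + |B|, the goal is linear in the products k k and k |B|, which the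
   next two equations supply. *)
have nE : n%:R + 1 = k%:R + (size B)%:R :> rat by rewrite natr1 kbE natrD.
have TTq : 2 * TT%:R + k%:R = k%:R * k%:R :> rat by rewrite -!natrM -natrD TTE.
have TBq : TB%:R + (M%:R + (size B)%:R) = k%:R * (size B)%:R :> rat.
  by rewrite -!natrM -!natrD TBE.
by rewrite nE; lra.
Qed.
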